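(* With probability $1$, the sample-functions of the Wiener process $W(t)$ ($t\ge 0$) are nowhere differentiable.
   Context: The Wiener process $W(t)$ ($t\ge 0$) is the standard one-dimensional Brownian motion: $W(0)=0$, the sample-functions are continuous on $[0,\infty)$, for $0\le s<t$ the increment $W(t)-W(s)$ is normally distributed with expectation $0$ and variance $t-s$, and increments over disjoint time intervals are independent. A sample-function is the path $t\mapsto W(t;\omega)$ for fixed $\omega$. *)

(* Defs.v *)
From HB Require Import structures.
From mathcomp Require Import all_boot all_order all_algebra.
From mathcomp Require Import all_classical all_reals all_analysis.
From mathcomp Require Import measurable_realfun.

Set Implicit Arguments.
Unset Strict Implicit.
Unset Printing Implicit Defensive.

Import Order.TTheory GRing.Theory Num.Theory.
Import numFieldTopology.Exports numFieldNormedType.Exports.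

Local Open Scope classical_set_scope.
Local Open Scope ring_scope.

(* Each [B i] may be [setT], so the product rule for the whole family contains
   the product rule for every subfamily. *)
Definition mutually_independent (d : measure_display) (T : measurableType d)
    (R : realType) (P : probability T R) (n : nat)
    (X : 'I_n -> {RV P >-> R}) : Prop :=
  forall B : 'I_n -> set R, (forall i, measurable (B i)) ->
    P (\bigcap_(i in [set: 'I_n]) (X i @^-1` B i)) =
    (\prod_(i < n) P (X i @^-1` B i))%E.

(* The time set is [0, +oo[: nothing is required of [W t] for [t < 0], and
   nothing below depends on it. The library's [normal_prob m s] takes the
   standard deviation [s], hence the square root of the variance. *)
Record wiener_process (d : measure_display) (T : measurableType d)
    (R : realType) (P : probability T R) (W : R -> {RV P >-> R}) : Prop := {
  wiener_start : forall w : T, W 0 w = 0 ;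
  wiener_continuous :
    forall w : T, {within `[0, +oo[, continuous (fun t : R => W t w)} ;
  wiener_normal : forall s t : R, 0 <= s -> s < t ->
    forall B : set R, measurable B ->
      distribution P (W t \- W s) B = normal_prob 0 (Num.sqrt (t - s)) B ;
  wiener_independent : forall (n : nat) (s t : 'I_n -> R),
    (forall i, 0 <= s i /\ s i < t i) ->
    (forall i j, i != j -> `]s i, t i] `&` `]s j, t j] = set0) ->
    mutually_independent
      (fun i => W (t i) \- W (s i) : {RV P >-> R})
}.

(* Existence of a finite derivative of [f] at [x], regarding [f] as a function
   on [D] only; at an endpoint of an interval [D] it is one-sided. *)
Definition derivable_within (R : realType) (D : set R) (f : R -> R) (x : R) :
    Prop :=
  cvg ((fun y => (f y - f x) / (y - x)) @ within D x^').

Definition nowhere_derivable_on (R : realType) (D : set R) (f : R -> R) :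
    Prop :=
  forall x, D x -> ~ derivable_within D f x.

Lemma derivable_within_interior (R : realType) (D : set R) (f : R -> R)
    (x : R) : D^° x -> derivable_within D f x <-> derivable f x 1.
Proof.
move=> Dx; rewrite /derivable_within /derivable.
have -> : within D x^' = x^'.
  apply/seteqP; split => A; rewrite /within/=; last exact: filterS.
  move=> h; apply: filterS2 h (nbhs_dnbhs Dx) => y; exact.
suff -> : (fun y => (f y - f x) / (y - x)) @ x^' =
    (fun h => h^-1 *: ((f \o shift x) (h *: 1) - f x)) @ 0^' by [].
have shiftE (Q : set R) :
    (\forall y \near x, Q y) = (\forall h \near (0 : R), Q (h + (x - 0))).
  exact: near_shift.
apply/seteqP; split => A.
  change ((\forall y \near x, y != x -> A ((f y - f x) / (y - x))) ->
    \forall h \near (0 : R), h != 0 ->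
      A (h^-1 * (f (h * 1 + x) - f x))).
  rewrite shiftE; apply: filterS => h; rewrite subr0 addrK mulr1 => hA h0.
  by rewrite mulrC; apply: hA; rewrite -subr_eq0 addrK.
change ((\forall h \near (0 : R), h != 0 ->
      A (h^-1 * (f (h * 1 + x) - f x))) ->
  \forall y \near x, y != x -> A ((f y - f x) / (y - x))).
rewrite shiftE; apply: filterS => h; rewrite subr0 addrK mulr1 => hA h0.
by rewrite mulrC; apply: hA; apply: contra_neq h0 => ->; rewrite add0r.
Qed.

(* Main.v *)
(* Dvoretzky-Erdos-Kakutani argument. If a path is differentiable at x, then it
   is Lipschitz at x with some constant K, so for every large n three consecutive
   increments over the grid of mesh 1/n just to the right of x are all O(K / n).
   Each increment has standard deviation n^(-1/2), so its density is at most
   n^(1/2), and by independence the three are O(K / n) with probability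
   O((n^(1/2) / n)^3) = O(n^(-3/2)). There are only O(n) possible positions of
   the triple when x stays bounded, and n * n^(-3/2) tends to 0. *)
Require Import Defs.
From mathcomp Require Import all_boot all_order all_algebra.
From mathcomp Require Import all_classical all_reals all_analysis.
From mathcomp Require Import measurable_realfun.
From mathcomp Require Import ring lra.

Import Order.TTheory GRing.Theory Num.Theory.
Import numFieldTopology.Exports numFieldNormedType.Exports.

Local Open Scope classical_set_scope.
Local Open Scope ring_scope.

Set Implicit Arguments.
Unset Strict Implicit.

(** The density never exceeds its peak $1/(s\sqrt{2\pi}) \le 1/s$, and the interval has length
    $2c$. *)
Lemma normal_prob_itv_le (R : realType) (m s c : R) : 0 < s -> 0 <= c ->
  (normal_prob m s `[(- c)%R, c] <= (2 * c / s)%:E)%E.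
Proof.
move=> s0 c0.
have sN0 : s != 0 by rewrite gt_eqF.
apply: (@le_trans _ _
  (\int[lebesgue_measure]_(x in `[(- c)%R, c]) (cst (normal_peak s)%:E x)))%E.
  apply: ge0_le_integral => //=.
  - by move=> x _; rewrite lee_fin normal_pdf_ge0.
  - apply/measurable_EFinP; apply: measurable_funTS.
    exact: measurable_normal_pdf.
  - by move=> x _; rewrite lee_fin normal_pdf_ub.
rewrite integral_cst//= lebesgue_measure_itv/=.
have peakV : normal_peak s <= s^-1.
  rewrite /normal_peak lef_pV2 ?posrE ?sqrtr_gt0 ?mulrn_wgt0//; last first.
    by rewrite mulr_gt0 ?exprn_gt0 ?pi_gt0.
  rewrite -[leLHS]gtr0_norm// -sqrtr_sqr ler_sqrt; last first.
    by rewrite mulrn_wge0 // mulr_ge0 ?sqr_ge0 ?pi_ge0.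
  rewrite -mulrnAr ler_peMr ?sqr_ge0// mulr2n.
  by have := @pi_ge2 R; lra.
case: ifP => _; last by rewrite mule0 lee_fin divr_ge0 ?mulr_ge0// ltW.
rewrite -EFinD -EFinM lee_fin opprK mulrC.
have -> : c + c = 2 * c by ring.
by rewrite ler_wpM2l// mulr_ge0.
Qed.

(** Near [x] the difference quotient is within 1 of its limit [l], so [|l| + 1] serves as the
    constant. *)
Lemma derivable_within_lipschitz (R : realType) (D : set R) (f : R -> R)
    (x : R) : derivable_within D f x ->
  exists M : R, \forall y \near x, D y -> `|f y - f x| <= M * `|y - x|.
Proof.
move=> /cvg_ex[l fl]; exists (`|l| + 1).
have /cvgrPdist_lt/(_ 1 ltr01) H := fl.
have : \forall y \near x, y != x -> D y -> `|l - (f y - f x) / (y - x)| < 1.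
  exact: H.
apply: filterS => y; have [->|yx] := eqVneq y x.
  by rewrite !subrr normr0 mulr0.
move=> /(_ isT) h /h {}h.
have yx0 : y - x != 0 by rewrite subr_eq0.
rewrite -[X in `|X| <= _](divfK yx0) normrM ler_wpM2r//.
rewrite -[X in `|X| <= _](subKr l) (le_trans (ler_normB _ _))// lerD2l.
exact: ltW.
Qed.

Lemma derivable_within_small_increments (R : realType) (f : R -> R) (x : R) :
    0 <= x -> derivable_within `[0, +oo[ f x ->
  exists K : nat, forall n : nat, (K < n)%N ->
    exists2 k : nat, (k < K.+1 * n)%N & forall i, (i < 3)%N ->
      `|f ((k + i).+1%:R / n%:R) - f ((k + i)%:R / n%:R)| <= K%:R * 8 / n%:R.
Proof.
move=> x0 /derivable_within_lipschitz[M /nbhs_ballP[e /= e0 fM]].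
(* A single natural number bounds the Lipschitz constant and the point [x], and [K < n] forces
   [4 / n < e]. Being an integer, it later indexes a countable union. *)
pose K := (Num.truncn `|M| + Num.truncn x + Num.truncn (4 / e)).+1.
have truncK (z : R) : 0 <= z -> (Num.truncn z < K)%N -> z < K%:R.
  move=> z0 zK; apply: lt_le_trans (truncnS_gt _) _.
  by rewrite ler_nat.
have MK : M <= K%:R.
  apply: le_trans (ler_norm _) (ltW _); apply: truncK => //.
  by rewrite ltnS -addnA leq_addr.
have xK : x < K%:R by apply: truncK => //; rewrite ltnS addnAC leq_addl.
have eK : 4 / e < K%:R.
  by apply: truncK; [rewrite divr_ge0// ltW|rewrite ltnS leq_addl].
exists K => n Kn.
have n0 : 0 < n%:R :> R by rewrite ltr0n (leq_ltn_trans _ Kn).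
have nx0 : 0 <= x * n%:R by rewrite mulr_ge0// ltW.
have /andP[kle ltk] := truncn_itv nx0.
set k := (Num.truncn (x * n%:R)) in kle ltk.
(* As [k] is the integer part of [x * n], starting at [k.+1] puts all four grid points in $(x, x +
   4/n]$, hence in the domain and in the ball around [x]. *)
exists k.+1.
  rewrite mulSn addnC -addn1 leq_add//; last by rewrite (leq_ltn_trans _ Kn).
  rewrite -(ltr_nat R) natrM (le_lt_trans kle)//.
  by rewrite ltr_pM2r.
have near_x j : (j <= 3)%N ->
    `|f ((k.+1 + j)%:R / n%:R) - f x| <= K%:R * 4 / n%:R.
  move=> j3; set y := _ / _.
  have yxE : y - x = ((k.+1 + j)%:R - x * n%:R) / n%:R.
    by rewrite mulrBl mulfK ?gt_eqF.
  have j3R : j%:R <= 3 :> R by rewrite (ler_nat R j 3).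
  have yx0 : 0 <= y - x.
    rewrite yxE divr_ge0 ?(ltW n0)// subr_ge0 ltW// (lt_le_trans ltk)//.
    by rewrite ler_nat leq_addr.
  have yx4 : y - x <= 4 / n%:R.
    rewrite yxE ler_pM2r ?invr_gt0// natrD -natr1.
    by have := kle; lra.
  have yxe : y - x < e.
    rewrite (le_lt_trans yx4)// ltr_pdivrMr// mulrC -ltr_pdivrMr//.
    by rewrite (lt_trans eK)// ltr_nat.
  have xy : ball x e y by rewrite /ball/= distrC ger0_norm.
  have Dy : `[0, +oo[%classic y by rewrite /= in_itv/= andbT; move: yx0 x0; lra.
  rewrite (le_trans (fM y xy Dy))// ger0_norm// -mulrA.
  by rewrite (le_trans (ler_wpM2r yx0 MK))// ler_wpM2l.
(* Comparing both ends of a cell with [f x] doubles the bound [K * 4 / n]. *)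
move=> i i3; rewrite -addnS.
rewrite (le_trans (ler_distD (f x) _ _))// [`|f x - _|]distrC.
rewrite (_ : 8 = 4 + 4); last by ring.
by rewrite mulrDr mulrDl lerD ?near_x// ltnW.
Qed.

(** An intersection of preimages over the whole of ['I_3] is the shape to which
    [mutually_independent] applies directly. *)
Definition small_increments (d : measure_display) (T : measurableType d)
    (R : realType) (P : probability T R) (W : R -> {RV P >-> R})
    (c : R) (n k : nat) : set T :=
  \bigcap_(i in [set: 'I_3])
    (W ((k + i).+1%:R / n%:R) \- W ((k + i)%:R / n%:R)) @^-1` `[- c, c].

Lemma measurable_small_increments (d : measure_display) (T : measurableType d)
    (R : realType) (P : probability T R) (W : R -> {RV P >-> R})
    (c : R) (n k : nat) : measurable (small_increments W c n k).
Proof.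
apply: fin_bigcap_measurable => // i _.
apply: (measurable_funPTI
  (W ((k + i).+1%:R / n%:R) \- W ((k + i)%:R / n%:R) : {RV P >-> R})).
exact: measurable_itv.
Qed.

Lemma small_increments_prob_le (d : measure_display) (T : measurableType d)
    (R : realType) (P : probability T R) (W : R -> {RV P >-> R})
    (c : R) (n k : nat) : wiener_process W -> 0 <= c -> (0 < n)%N ->
  (P (small_increments W c n k) <= ((2 * c * Num.sqrt n%:R) ^+ 3)%:E)%E.
Proof.
move=> hW c0 n0; have n0R : 0 < n%:R :> R by rewrite ltr0n.
have lt_step j : j%:R / n%:R < j.+1%:R / n%:R :> R.
  by rewrite ltr_pM2r ?invr_gt0// ltr_nat.
have ge0_step j : 0 <= j%:R / n%:R :> R by rewrite divr_ge0.
pose incr (i : 'I_3) : {RV P >-> R} :=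
  W ((k + i).+1%:R / n%:R) \- W ((k + i)%:R / n%:R).
have indep := @wiener_independent _ _ _ _ _ hW 3
  (fun i => (k + i)%:R / n%:R) (fun i => (k + i).+1%:R / n%:R).
rewrite indep//; last first.
  (* A common point of the half-open cells [i] and [j] would give both [i <= j] and [j <= i]. *)
  move=> i j ij; apply/seteqP; split => // y [] /=.
  rewrite !in_itv/= => /andP[iy yi] /andP[jy yj].
  have : (k + i)%:R / n%:R < (k + j).+1%:R / n%:R :> R by exact: lt_le_trans yj.
  have : (k + j)%:R / n%:R < (k + i).+1%:R / n%:R :> R by exact: lt_le_trans yi.
  rewrite !ltr_pM2r ?invr_gt0// !ltr_nat !ltnS !leq_add2l => ji ij'.
  by move: ij; rewrite -val_eqE eqn_leq ij' ji.
have bound (i : 'I_3) :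
    (P (incr i @^-1` `[(- c)%R, c]) <= (2 * c * Num.sqrt n%:R)%:E)%E.
  have := @wiener_normal _ _ _ _ _ hW _ _ (ge0_step (k + i)%N)
    (lt_step (k + i)%N) `[- c, c]%classic (measurable_itv _).
  rewrite /distribution/pushforward => ->.
  (* The variance is the mesh [1 / n], so dividing by the standard deviation multiplies by $\sqrt
     n$. *)
  rewrite -mulrBl -natrB// subSnn mul1r.
  have sd0 : 0 < Num.sqrt n%:R^-1 :> R by rewrite sqrtr_gt0 invr_gt0.
  rewrite (le_trans (normal_prob_itv_le _ sd0 c0))//.
  by rewrite sqrtrV ?ler0n// invrK.
move: (2 * c * Num.sqrt n%:R) bound => b bound.
rewrite !big_ord_recl big_ord0 mule1 exprS expr2 !EFinM.
apply: lee_pmul => //; [exact: mule_ge0|exact: bound|].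
by apply: lee_pmul => //; exact: bound.
Qed.

(** The intersection lies in each of its members, so it suffices that their probabilities tend to 0
    along a subsequence. *)
Lemma small_increments_negligible (d : measure_display) (T : measurableType d)
    (R : realType) (P : probability T R) (W : R -> {RV P >-> R}) (K : nat) :
  wiener_process W ->
  P.-negligible (\bigcap_(n in [set n | (K < n)%N])
    \bigcup_(k < (K.+1 * n)%N) small_increments W (K%:R * 8 / n%:R) n k).
Proof.
move=> hW; set B := fun n => \bigcup_(k < (K.+1 * n)%N) _.
have mB n : measurable (B n).
  by apply: bigcup_measurable => k _; exact: measurable_small_increments.
have mI : measurable (\bigcap_(n in [set n | (K < n)%N]) B n).
  by apply: bigcap_measurableType => n _.
apply/negligibleP => //; apply/eqP; rewrite -measure_le0.
(* For [n = m ^ 2] there are $(K+1)m^2$ positions, each of probability at most $(16K/m)^3$; the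
   product is [C / m]. *)
pose C : R := K.+1%:R * (16 * K%:R) ^+ 3.
(* Along n = m ^ 2 the standard deviation of an increment is just 1 / m. *)
have PB m : (K < m)%N -> (P (B (m ^ 2)%N) <= (C / m%:R)%:E)%E.
  move=> Km; have m0 : (0 < m)%N by rewrite (leq_ltn_trans _ Km).
  have m0R : 0 < m%:R :> R by rewrite ltr0n.
  rewrite /B bigcup_mkord (le_trans (Boole_inequality _ _))//.
    by move=> *; exact: measurable_small_increments.
  apply: (@le_trans _ _ (\sum_(k < (K.+1 * m ^ 2)%N)
      ((2 * (K%:R * 8 / (m ^ 2)%:R) * Num.sqrt (m ^ 2)%:R) ^+ 3)%:E)%E).
    apply: lee_sum => k _; apply: small_increments_prob_le => //.
    by rewrite expn_gt0 m0.
  rewrite sumEFin lee_fin sumr_const card_ord -mulr_natr.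
  rewrite [in X in _ * X]natrM natrX sqrtr_sqr ger0_norm// /C.
  by rewrite le_eqVlt; apply/orP; left; apply/eqP; field; rewrite gt_eqF.
apply/lee_addgt0Pr => e e0; rewrite add0e.
(* This [m] exceeds both [K], so that [m ^ 2] is an admissible index, and [C / e]. *)
pose m := (K + Num.truncn (C / e)).+1.
have Km : (K < m)%N by rewrite ltnS leq_addr.
have m0R : 0 < m%:R :> R by rewrite ltr0n.
apply: (@le_trans _ _ (P (B (m ^ 2)%N))).
  rewrite le_measure ?inE//; apply: bigcap_inf => /=.
  by rewrite (leq_trans Km)// -[leqLHS]expn1 leq_pexp2l.
rewrite (le_trans (PB _ Km))// lee_fin ler_pdivrMr// mulrC -ler_pdivrMr//.
by rewrite ltW// (lt_le_trans (truncnS_gt _))// ler_nat ltnS leq_addl.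
Qed.

Unset Implicit Arguments.
Set Strict Implicit.

Theorem theorem5 (d : measure_display) (T : measurableType d) (R : realType)
    (P : probability T R) (W : R -> {RV P >-> R}) (hW : wiener_process W) :
  {ae P, forall w : T, nowhere_derivable_on `[0, +oo[ (fun t : R => W t w)}.
Proof.
(* The exceptional set is covered by countably many null sets, one for each [K]; the constant [K]
   found for a path differentiable somewhere tells which of them contains it. *)
apply: negligibleS (negligible_bigcup
  (fun K => small_increments_negligible K hW)) => w /=.
move=> /existsNP[x /not_implyP[x0 /contrapT Wx]].
have {}x0 : 0 <= x by move: x0; rewrite /= in_itv/= andbT.
have [K WK] := derivable_within_small_increments x0 Wx.
exists K => //= n /WK[k kn kW]; exists k => // i _ /=.
by rewrite in_itv/= -ler_norml kW.
Qed.
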